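(* Let $m\neq\pm1$ be a square-free integer, $k$ a positive integer, $p$ a prime with $p\nmid m$, $n=p^k$, $\alpha$ a root of $X^n-m$, $r$ the remainder of $m$ modulo $p^{k+1}$, $s:=v_p(m^p-m)-1$, and for $t\in\mathbb{N}$ let $h^{(r)}_t(X)=\frac{X^{p^k}-r^{p^t}}{X^{p^{k-t}}-r}=\sum_{i=0}^{p^t-1} r^{i}X^{p^k-(i+1)p^{k-t}}\in\mathbb{Z}[X]$. (i) If $s<k$, then the elements $\alpha^j\frac{h^{(r)}_t(\alpha)}{p^t}$ ($0\leq t\leq s-1$, $0\leq j\leq p^{k-t}-p^{k-t-1}-1$) together with $\alpha^j\frac{h^{(r)}_s(\alpha)}{p^s}$ ($0\leq j\leq p^{k-s}-1$) form an integral basis of $\mathbb{Q}(\alpha)$. (ii) If $s\geq k$, then the elements $\alpha^j\frac{h^{(r)}_t(\alpha)}{p^t}$ ($0\leq t\leq k-1$, $0\leq j\leq p^{k-t}-p^{k-t-1}-1$) together with $\frac{h^{(r)}_k(\alpha)}{p^k}$ form an integral basis of $\mathbb{Q}(\alpha)$.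
   Context: $v_p$ denotes the $p$-adic valuation on $\mathbb{Q}$. An integral basis of a number field is a $\mathbb{Z}$-basis of its ring of integers. *)

(* Defs.v *)
From HB Require Import structures.
From mathcomp Require Import all_boot all_order all_algebra all_field.
Set Implicit Arguments. Unset Strict Implicit. Unset Printing Implicit Defensive.
Import Order.TTheory GRing.Theory Num.Theory.
Local Open Scope ring_scope.

Definition squarefree_int (m : int) : Prop :=
  m != 0 /\ forall d : nat, (d * d %| absz m)%N -> d = 1%N.

Definition in_Qadj (a x : algC) : Prop :=
  exists q : {poly rat}, x = (map_poly ratr q).[a].

Definition in_ring_of_integers (a x : algC) : Prop := in_Qadj a x /\ x \in Aint.

Definition integral_basis (a : algC) (b : seq algC) : Prop :=
  [/\ forall i : 'I_(size b), in_ring_of_integers a b`_i,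
      forall x, in_ring_of_integers a x ->
        exists c : 'I_(size b) -> int, x = \sum_(i < size b) (c i)%:~R * b`_i
    & forall c : 'I_(size b) -> int,
        \sum_(i < size b) (c i)%:~R * b`_i = 0 -> forall i, c i = 0].

Definition hpoly (p k : nat) (r : int) (t : nat) : {poly int} :=
  \sum_(i < p ^ t) (r ^+ i)%:P * 'X^(p ^ k - i.+1 * p ^ (k - t)).

Definition hel (p k : nat) (r : int) (a : algC) (t j : nat) : algC :=
  a ^+ j * (map_poly intr (hpoly p k r t)).[a] / (p ^ t)%:R.

Definition s_val (p : nat) (m : int) : nat := (logn p (absz (m ^+ p - m)) - 1)%N.

Definition r_val (p k : nat) (m : int) : int := (m %% (p ^ k.+1)%N%:Z)%Z.

Definition basis_i (p k : nat) (r : int) (a : algC) (s : nat) : seq algC :=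
  flatten [seq [seq hel p k r a t j | j <- iota 0 (p ^ (k - t) - p ^ (k - t - 1))]
          | t <- iota 0 s]
  ++ [seq hel p k r a s j | j <- iota 0 (p ^ (k - s))].

Definition basis_ii (p k : nat) (r : int) (a : algC) : seq algC :=
  flatten [seq [seq hel p k r a t j | j <- iota 0 (p ^ (k - t) - p ^ (k - t - 1))]
          | t <- iota 0 k]
  ++ [:: hel p k r a k 0].

(* Main.v *)
(** Write [n = p^k], [S = min s k], [g_t = a^(p^(k-t))], [b_t = h_t(a) / p^t] and
    [u = a - r].  Then [b_t (g_t - r)] is an integer divisible by [p], which makes
    [b_t] integral, and
    [p b_(t+1) = (g_(t+1)^p - r^p) / (g_(t+1) - r) * b_t + (r^p - r) / p^t * D]
    with [D] in [Z[a]], which makes the span [B] of the proposed basis a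
    [Z[a]]-module.

    Conversely, Fourier inversion over the conjugates of [a] shows that [n x] lies
    in [Z[a]] for every integer [x] of [Q(a)], so it is enough that [p x] in [B]
    implies [x] in [B]; as [u^n] is in [p Z[a]], one may also assume [u x] in [B].
    Modulo [u B], [u x] is a combination [\sum_t e_t b_t]; it is nilpotent modulo
    [p], and traces of the [b_t] force [p] to divide every [e_t].  Modulo [u B],
    each [p b_t] is an integer multiple of [p], so [u x = p e] with [e] an integer,
    after changing [x] modulo [B].  If [S = s < k], [p w] is in [u B] for some [w]
    prime to [p], so [w x] is in [B].  If [S = k], [u b_k] is an integer, so that [x]
    is a rational multiple of [b_k], and the multiplier is [p]-integral because
    [b_k] is not nilpotent modulo [p]. *)

Require Import Defs.
From HB Require Import structures.
From mathcomp Require Import all_boot all_order all_algebra all_field.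
From mathcomp Require Import ring zify.
Import Order.TTheory GRing.Theory Num.Theory.
Local Open Scope ring_scope.

Local Notation pQtoC := (map_poly (ratr : rat -> algC)).
Local Notation pZtoC := (map_poly (intr : int -> algC)).

(** * Valuations of square-free integers *)

Lemma logn_squarefree_le1 (m : int) (q : nat) :
  squarefree_int m -> (logn q (absz m) <= 1)%N.
Proof.
case=> m0 sqf; rewrite leqNgt; apply/negP => lt1.
have q_pr : prime q by move: lt1; rewrite lognE; case: (prime q).
have := sqf q; rewrite mulnn pfactor_dvdn ?absz_gt0 // => /(_ lt1) q1.
by rewrite q1 in q_pr.
Qed.

Lemma squarefree_prime_exact (m : int) :
  squarefree_int m -> m != 1 -> m != -1 ->
  exists2 q, prime q & logn q (absz m) = 1%N.
Proof.
move=> sqf m1 mN1; have [m0 _] := sqf.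
have gt1 : (1 < absz m)%N by lia.
exists (pdiv (absz m)); first exact: pdiv_prime.
apply/eqP; rewrite eqn_leq logn_squarefree_le1 //=.
by rewrite logn_gt0 mem_primes pdiv_prime // pdiv_dvd absz_gt0 m0.
Qed.

(** * Integers of pure extensions *)

Section Radical.

Variables (m : int) (n : nat) (a : algC).
Hypotheses (m_sqf : squarefree_int m) (m_neq1 : m != 1) (m_neqN1 : m != -1).
Hypotheses (n_gt0 : (0 < n)%N) (anE : a ^+ n = m%:~R).

Lemma Aint_radical x : x ^+ n = m%:~R -> x \in Aint.
Proof.
move=> xnE; apply: (@root_monic_Aint ('X^n - m%:~R%:P)).
- by rewrite /root !hornerE xnE subrr.
- exact: monicXnsubC.
by rewrite polyOverXnsubC intr_int.
Qed.

(* The constant term [c] of the minimal polynomial is, up to sign, a product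
   of [d] roots of [X^n - m], so [|c|^n = |m|^d]; compare valuations at a prime
   dividing [m] exactly once. *)
Lemma radical_min_size (G : {poly rat}) :
  root (pQtoC G) a -> G != 0 -> (n < size G)%N.
Proof.
move=> Ga0 G0; have [q q_pr mq1] := squarefree_prime_exact _ m_sqf m_neq1 m_neqN1.
have [P [minP P_monic divP]] := minCpolyP a.
have PG : P %| G by rewrite -divP.
apply: leq_trans (dvdp_leq G0 PG).
have [rs rsE] := closed_field_poly_normal (pQtoC P).
have lc1 : lead_coef (pQtoC P) = 1 by rewrite lead_coef_map (monicP P_monic) rmorph1.
rewrite lc1 scale1r in rsE.
have szP : size P = (size rs).+1.
  by rewrite -(size_map_poly (ratr : {rmorphism rat -> algC})) rsE size_prod_XsubC.
have rsn z : z \in rs -> z ^+ n = m%:~R.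
  rewrite -root_prod_XsubC -rsE => Pz0.
  have: P %| 'X^n - m%:~R%:P.
    by rewrite -divP rmorphB /= map_polyXn map_polyC /= ratr_int /root !hornerE anE subrr.
  rewrite -(dvdp_map (ratr : {rmorphism rat -> algC})) => /dvdpP [Q].
  rewrite rmorphB /= map_polyXn map_polyC /= ratr_int => QE.
  move/rootP: Pz0 => Pz0; have := congr1 (fun T => T.[z]) QE.
  by rewrite !hornerE Pz0 mulr0 => /eqP; rewrite subr_eq0 => /eqP.
have P0E : ratr P`_0 = \prod_(z <- rs) - z :> algC.
  rewrite -coef_map rsE -horner_coef0 horner_prod.
  by apply: eq_bigr => z _; rewrite !hornerE.
have P0n : (ratr P`_0 : algC) ^+ n = ((-1) ^+ n * m%:~R) ^+ size rs.
  rewrite P0E -prodrXl big_seq (eq_bigr (fun=> (-1) ^+ n * m%:~R)).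
    by rewrite -big_seq big_const_seq count_predT iter_mulr_1.
  by move=> z /rsn <-; exact: exprNn.
have /intrP [c cE] : (ratr P`_0 : algC) \in Num.int.
  apply: Cint_rat_Aint; first exact: Crat_rat.
  rewrite P0E big_seq rpred_prod // => z /rsn zn.
  by rewrite rpredN Aint_radical.
have cn : c ^+ n = ((-1) ^+ n * m) ^+ size rs.
  by apply: (intr_inj (R := algC)); rewrite !(rmorphXn, rmorphM, rmorphN1) /= -cE.
have {}cn : (absz c ^ n = absz m ^ size rs)%N.
  by have := congr1 absz cn; rewrite !(abszX, abszM) /= exp1n mul1n.
have ndvd : (n %| size rs)%N.
  have := congr1 (logn q) cn; rewrite !lognX mq1 muln1 => <-.
  exact: dvdn_mulr.
rewrite szP ltnS dvdn_leq //.
have := size_minCpoly a.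
by rewrite minP (size_map_poly (ratr : {rmorphism rat -> algC})) szP.
Qed.

(** The remainder of [G] modulo [X^n - m] vanishes at [a] and has degree below [n], so
    [radical_min_size] forces it to be zero; hence [X^n - m] divides [G]. *)
Lemma radical_root_transfer (G : {poly rat}) (b : algC) :
  root (pQtoC G) a -> b ^+ n = m%:~R -> root (pQtoC G) b.
Proof.
move=> Ga0 bn; pose F : {poly rat} := 'X^n - m%:~R%:P.
have FE : pQtoC F = 'X^n - m%:~R%:P.
  by rewrite rmorphB /= map_polyXn map_polyC /= ratr_int.
have szF : size F = n.+1 by rewrite size_XnsubC.
have F0 : F != 0 by rewrite -size_poly_gt0 szF.
have GE := congr1 pQtoC (divp_eq G F).
rewrite rmorphD rmorphM /= FE in GE.
have r0 : G %% F = 0.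
  apply/eqP/negP => /negP r0.
  have : root (pQtoC (G %% F)) a.
    move: Ga0; rewrite GE /root !hornerE anE subrr mulr0 add0r.
    by [].
  move/radical_min_size => /(_ r0); rewrite ltnNge -ltnS -szF.
  by rewrite ltn_modp F0.
by rewrite GE r0 rmorph0 addr0 /root !hornerE bn subrr mulr0.
Qed.

(** Let [P] be the minimal polynomial of [G(a)]. Then [P] composed with [G] vanishes at [a], hence
    at [b], so [G(b)] is a root of the same monic integer polynomial. *)
Lemma Aint_conjugate (G : {poly rat}) (b : algC) :
  (pQtoC G).[a] \in Aint -> b ^+ n = m%:~R -> (pQtoC G).[b] \in Aint.
Proof.
move=> GaA bn; set x := (pQtoC G).[a] in GaA.
have [P [minP P_monic divP]] := minCpolyP x.
have Gx : root (pQtoC (P \Po G)) a.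
  by rewrite map_comp_poly /root horner_comp -/x -minP -/(root _ _) root_minCpoly.
have := radical_root_transfer _ _ Gx bn.
rewrite map_comp_poly /root horner_comp -minP => root_b.
apply: root_monic_Aint root_b (minCpoly_monic x) _.
by move: GaA; rewrite unfold_in.
Qed.

Lemma radical_coef_eq0 (G : {poly rat}) :
  (size G <= n)%N -> (pQtoC G).[a] = 0 -> G = 0.
Proof.
move=> szG Ga0; apply/eqP/negP => /negP G0.
by have := radical_min_size _ (introT rootP Ga0) G0; rewrite ltnNge szG.
Qed.

Lemma radical_reduced (x : algC) : in_Qadj a x ->
  exists2 G : {poly rat}, (size G <= n)%N & x = (pQtoC G).[a].
Proof.
case=> q ->; pose F : {poly rat} := 'X^n - m%:~R%:P.
have szF : size F = n.+1 by rewrite size_XnsubC.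
have F0 : F != 0 by rewrite -size_poly_gt0 szF.
exists (q %% F); first by rewrite -ltnS -szF ltn_modp.
rewrite {1}(divp_eq q F) rmorphD rmorphM /= rmorphB /= map_polyXn map_polyC /=.
by rewrite ratr_int !hornerE anE subrr mulr0 add0r.
Qed.

(** A prime [q] dividing the denominator of [y] would give [q^n | m^i], whereas square-freeness
    bounds the valuation of [m^i] at [q] by [i < n]. *)
Lemma rat_int_of_radical_power (y : rat) (i : nat) (e : int) :
  (i < n)%N -> y ^+ n * m%:~R ^+ i = e%:~R -> exists c : int, y = c%:~R.
Proof.
move=> lt_in yE; have [m0 _] := m_sqf.
have d0 : (denq y)%:~R != 0 :> rat by rewrite intr_eq0 denq_neq0.
have E : numq y ^+ n * m ^+ i = e * denq y ^+ n.
  apply: (intr_inj (R := rat)); rewrite !(rmorphM, rmorphXn) /= -yE.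
  by rewrite -{2}(divq_num_den y) expr_div_n mulrAC divfK ?expf_neq0.
have dvd1 : (absz (denq y) ^ n %| absz m ^ i)%N.
  rewrite -(@Gauss_dvdr _ (absz (numq y) ^ n)).
    have := congr1 absz E; rewrite !(abszM, abszX) => ->.
    exact: dvdn_mull.
  by rewrite coprimeXl ?coprimeXr // coprime_sym coprime_num_den.
have d1 : absz (denq y) = 1%N.
  apply/eqP/negP => /negP dN1.
  have dgt1 : (1 < absz (denq y))%N.
    by have := denq_gt0 y; move: dN1; lia.
  have q_pr := pdiv_prime dgt1; set q := pdiv _ in q_pr.
  have : (n <= i)%N.
    apply: leq_trans (_ : i * logn q (absz m) <= i)%N; last first.
      by rewrite -[leqRHS]muln1 leq_mul2l logn_squarefree_le1 ?orbT.
    rewrite -lognX.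
    apply: leq_trans (dvdn_leq_log q _ dvd1); last first.
      by rewrite expn_gt0 absz_gt0 m0.
    rewrite lognX leq_pmulr // logn_gt0 mem_primes q_pr pdiv_dvd absz_gt0.
    by rewrite denq_neq0.
  by rewrite leqNgt lt_in.
exists (numq y); rewrite -[LHS]divq_num_den.
have -> : denq y = 1 by have := denq_gt0 y; lia.
by rewrite divr1.
Qed.

(* Fourier inversion over the conjugates [z^j a] isolates [n c_i a^i]. *)
Lemma radical_coef_int (G : {poly rat}) (i : nat) :
  (size G <= n)%N -> (i < n)%N -> (pQtoC G).[a] \in Aint ->
  exists c : int, n%:R * G`_i = c%:~R.
Proof.
move=> szG lt_in GA; have [z z_prim] := C_prim_root_exists n_gt0.
have zn : z ^+ n = 1 := prim_expr_order z_prim.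
have zA : z \in Aint := Aint_prim_root z_prim.
have conjA j : (pQtoC G).[z ^+ j * a] \in Aint.
  by apply: Aint_conjugate => //; rewrite exprMn anE exprAC zn expr1n mul1r.
have sumE : \sum_(j < n) (pQtoC G).[z ^+ j * a] * z ^+ (j * (n - i))
            = n%:R * ratr G`_i * a ^+ i.
  transitivity (\sum_(l < n) ratr G`_l * a ^+ l *
      \sum_(j < n) (z ^+ (l + (n - i))) ^+ j).
    under eq_bigr => j _.
      rewrite (@horner_coef_wide _ n) ?(leq_trans (size_poly _ _)) // mulr_suml.
      over.
    rewrite exchange_big; apply: eq_bigr => l _; rewrite mulr_sumr.
    apply: eq_bigr => j _; rewrite coef_map exprMn -!exprM /=.
    by rewrite mulnDl exprD [(l * j)%N]mulnC [((n - i) * j)%N]mulnC; ring.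
  rewrite (bigD1 (Ordinal lt_in)) //= subnKC ?(ltnW lt_in) // zn.
  under eq_bigr do rewrite expr1n.
  rewrite sumr_const card_ord big1 ?addr0; first by ring.
  move=> l neq_li; set w := z ^+ _.
  have w1 : w != 1.
    rewrite -(prim_order_dvd z_prim); apply/negP => /dvdnP [q qE].
    have := ltn_ord l; have neq : (l : nat) <> i.
      by move=> li; case/eqP: neq_li; apply: val_inj.
    have : (q = 0 \/ q = 1 \/ 2 <= q)%N by lia.
    case=> [q0|[q1|q2]]; [subst q; lia | subst q; lia |].
    by have := leq_mul q2 (leqnn n); lia.
  have := subrX1 w n; rewrite -exprM mulnC exprM zn expr1n subrr => /esym/eqP.
  by rewrite mulf_eq0 subr_eq0 (negPf w1) => /eqP->; rewrite mulr0.
have SA : n%:R * ratr G`_i * a ^+ i \in Aint.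
  by rewrite -sumE rpred_sum // => j _; rewrite rpredM ?conjA ?rpredX.
(* The algebraic integer [n c_i a^i] need not be rational, but its [n]-th power is, since
   [a^n = m]. *)
have /intrP [e eE] : (n%:R * ratr G`_i * a ^+ i) ^+ n \in Num.int.
  apply: Cint_rat_Aint; last by rewrite rpredX.
  rewrite exprMn exprAC anE; apply/CratP; exists ((n%:R * G`_i) ^+ n * m%:~R ^+ i).
  by rewrite !(rmorphM, rmorphXn, rmorph_int, rmorph_nat).
apply: (@rat_int_of_radical_power _ i e) => //.
apply: (fmorph_inj (ratr : {rmorphism rat -> algC})).
rewrite !(rmorphM, rmorphXn, rmorph_int, rmorph_nat) -eE /=.
by rewrite [RHS]exprMn exprAC anE.
Qed.

End Radical.

(** * Congruences and geometric sums *)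

Lemma dvdz_subX (d x y : int) (l : nat) :
  (d %| x - y)%Z -> (d %| x ^+ l - y ^+ l)%Z.
Proof. by move=> dxy; rewrite subrXX dvdz_mulr. Qed.

(** The quotient [(y^N - r^N) / (y - r)] written as a sum, so that it keeps its meaning at [y = r];
    [h_t(a)] is the case [N = p^t], [y = g_t]. *)
Definition geom {R : comNzRingType} (N : nat) (r y : R) : R :=
  \sum_(i < N) y ^+ (N.-1 - i) * r ^+ i.

Lemma geomE {R : comNzRingType} (N : nat) (r y : R) :
  (y - r) * geom N r y = y ^+ N - r ^+ N.
Proof. by rewrite subrXX. Qed.

Lemma geom_diag {R : comNzRingType} (N : nat) (r : R) :
  geom N r r = r ^+ N.-1 *+ N.
Proof.
rewrite /geom (eq_bigr (fun=> r ^+ N.-1)); first by rewrite sumr_const card_ord.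
by case: N => [|N] [i /= ?] _ //; rewrite -exprD subnK.
Qed.

(** Modulo [N] each of the [N] terms of the sum is congruent to [y^(N-1)]. *)
Lemma dvdz_geom (N : nat) (x y : int) :
  (N%:Z %| x - y)%Z -> (N%:Z %| geom N y x)%Z.
Proof.
move=> Nxy; have -> : geom N y x = y ^+ N.-1 * N%:Z +
    \sum_(i < N) (x ^+ (N.-1 - i) - y ^+ (N.-1 - i)) * y ^+ i.
  under [in RHS]eq_bigr do rewrite mulrBl.
  rewrite sumrB -/(geom N y x) -/(geom N y y) geom_diag -mulr_natr natz.
  by rewrite addrC subrK.
rewrite rpredD ?dvdz_mull // rpred_sum // => i _.
by rewrite dvdz_mulr // dvdz_subX.
Qed.

Lemma dvdz_lift (p e : nat) (x y : int) :
  (p%:Z ^+ e.+1 %| x - y)%Z -> (p%:Z ^+ e.+2 %| x ^+ p - y ^+ p)%Z.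
Proof.
move=> exy; rewrite -geomE exprSr dvdz_mul // dvdz_geom //.
by apply: dvdz_trans exy; rewrite exprS dvdz_mulr.
Qed.

Lemma dvdz_exp_sub (p e j : nat) (m : int) :
  (p%:Z ^+ e %| m ^+ p - m)%Z -> (p%:Z ^+ e %| m ^+ (p ^ j) - m)%Z.
Proof.
move=> em; elim: j => [|j IH]; first by rewrite subrr.
rewrite expnS exprM -(subrKA (m ^+ (p ^ j))) rpredD //.
exact: dvdz_subX.
Qed.

Lemma prime_dvdz_fermat (p : nat) (m : int) : prime p -> (p%:Z %| m ^+ p - m)%Z.
Proof.
move=> p_pr; rewrite (dvdz_pcharf (pchar_Fp p_pr)).
rewrite rmorphB rmorphXn /= subr_eq0; apply/eqP.
by have := expf_card (m%:~R : 'F_p); rewrite card_Fp.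
Qed.

(* [(i+1) C(N, i+1) = N C(N-1, i)], and [p^v | i+1] forces [v <= i]. *)
Lemma dvdn_bin_prime_power (p t i : nat) :
  prime p -> (p ^ t %| 'C(p ^ t, i.+1) * p ^ i)%N.
Proof.
move=> p_pr; have [c cop iE] := pfactor_coprime p_pr (ltn0Sn i).
set v := logn p i.+1 in iE.
have le_vi : (v <= i)%N.
  rewrite -ltnS; apply: leq_trans (ltn_expl v (prime_gt1 p_pr)) _.
  by rewrite dvdn_leq // iE dvdn_mull.
apply: (@dvdn_trans ('C(p ^ t, i.+1) * p ^ v)); last by rewrite dvdn_mul // dvdn_exp2l.
rewrite -(@Gauss_dvdr _ c) ?coprimeXl //.
have -> : (c * ('C(p ^ t, i.+1) * p ^ v) = i.+1 * 'C(p ^ t, i.+1))%N.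
  by rewrite mulnCA -iE mulnC.
by rewrite -mul_bin_diag dvdn_mulr.
Qed.

(* Expanding [geom N r g] in powers of [g - r] and using [b (g - r) = L] gives
   [b^N = \sum_i 'C(N, i+1) L^i / N * r^(N-1-i) b^(N-1-i)]. *)
Lemma Aint_geom_div (p t : nat) (r L : int) (g : algC) :
  prime p -> (p%:Z %| L)%Z ->
  let b := geom (p ^ t) r%:~R g / (p ^ t)%:R in
  (g - r%:~R) * b = L%:~R -> b \in Aint.
Proof.
move=> p_pr pL b; set N := (p ^ t)%N in b *; set u := g - r%:~R => ub.
have N_gt0 : (0 < N)%N by rewrite expn_gt0 prime_gt0.
have N0 : N%:R != 0 :> algC by rewrite pnatr_eq0 -lt0n.
have NbE : N%:R * b = \sum_(i < N) 'C(N, i.+1)%:R * r%:~R ^+ (N.-1 - i) * u ^+ i.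
  (* The binomial identity comes from cancelling [u]; when [u = 0], only the term [i = 0] survives
     and [geom_diag] gives it. *)
  rewrite mulrC divfK //; have [u0|u0] := eqVneq u 0.
    have -> : g = r%:~R by apply/eqP; rewrite -subr_eq0 -/u u0.
    rewrite geom_diag (bigD1 (Ordinal N_gt0)) //= bin1 u0 big1.
      by rewrite subn0 expr0; ring.
    move=> i; rewrite -val_eqE /= -lt0n => i0.
    by rewrite expr0n eqn0Ngt i0 mulr0.
  apply: (mulfI u0); rewrite geomE mulr_sumr.
  have -> : g = r%:~R + u by rewrite /u; ring.
  rewrite exprDn big_ord_recl /= subn0 bin0 expr0 mulr1 mulr1n addrC addKr.
  apply: eq_bigr => i _; rewrite /bump /= add1n exprS subnS -predn_sub.
  by rewrite -mulr_natl; ring.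
(* As [p] divides [L], the factor [L^i] supplies the [p^i] that makes the binomial coefficient
   divisible by [N]. *)
have pc i : exists d : int, 'C(N, i.+1)%:Z * L ^+ i = N%:Z * d.
  have /dvdzP [d dE] : (N%:Z %| 'C(N, i.+1)%:Z * L ^+ i)%Z.
    have [l ->] := dvdzP pL.
    rewrite exprMn mulrCA dvdz_mull //.
    have -> : 'C(N, i.+1)%:Z * p%:Z ^+ i = ('C(N, i.+1) * p ^ i)%N.
      by rewrite PoszM -!natz natrX.
    exact: (dvdn_bin_prime_power p t i p_pr).
  by exists d; rewrite dE mulrC.
have [d dE] : exists d : 'I_N -> int,
    forall i : 'I_N, 'C(N, i.+1)%:Z * L ^+ i = N%:Z * d i.
  exact: (fin_all_exists (fun i : 'I_N => pc i)).
have bNE : b ^+ N = \sum_(i < N) (d i * r ^+ (N.-1 - i))%:~R * b ^+ (N.-1 - i).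
  have -> : b ^+ N = b ^+ N.-1 * b by rewrite -exprSr prednK.
  apply: (mulfI N0); rewrite mulrCA NbE !mulr_sumr.
  apply: eq_bigr => i _.
  have -> : b ^+ N.-1 = b ^+ i * b ^+ (N.-1 - i).
    by rewrite -exprD subnKC // -ltnS prednK.
  rewrite rmorphM rmorphXn /=.
  have := congr1 (fun z : int => z%:~R : algC) (dE i).
  rewrite !rmorphM rmorphXn /= -!pmulrn -ub exprMn.
  set C := 'C(_, _)%:R => CE; set R := r%:~R ^+ (N.-1 - i); set T := b ^+ (N.-1 - i).
  transitivity (C * (u ^+ i * b ^+ i) * R * T); first by ring.
  by rewrite CE; ring.
pose P := 'X^N - \sum_(i < N) (d i * r ^+ (N.-1 - i))%:~R *: 'X^(N.-1 - i) : {poly algC}.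
apply: (@root_monic_Aint P).
- rewrite /root /P !hornerE horner_sum bNE subr_eq0; apply/eqP.
  by apply: eq_bigr => i _; rewrite hornerZ hornerXn.
- rewrite monicE /P lead_coefDl ?lead_coefXn // size_polyN size_polyXn ltnS.
  apply: leq_trans (size_sum _ _ _) _; apply/bigmax_leqP => i _.
  apply: leq_trans (size_scale_leq _ _) _; rewrite size_polyXn.
  by rewrite -[leqRHS](prednK N_gt0) ltnS leq_subr.
apply/polyOverP => j; rewrite coefB coefXn coef_sum rpredB ?rpred_nat //.
by rewrite rpred_sum // => i _; rewrite coefZ coefXn rpredM ?rpred_nat ?intr_int.
Qed.

(** If [r^p] were [r], the quotient would factor exactly through [y^p]. In general put
    [F = geom N r X^p]; the error is [r^p - r] times [D = (F - F(r)) / (X - r)], which has integer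
    coefficients. *)
Lemma geom_step (p N : nat) (r : int) :
  exists D : {poly int}, forall y : algC,
    geom (p * N) r%:~R y
    = geom N r%:~R (y ^+ p) * geom p r%:~R y + (r ^+ p - r)%:~R * (pZtoC D).[y].
Proof.
pose F := geom N r%:P ('X^p : {poly int}).
have /factor_theorem [D DE] : root (F - F.[r]%:P) r.
  by rewrite /root !hornerE subrr.
have FrE : (r ^+ p - r) * F.[r] = r ^+ (p * N) - r ^+ N.
  have := congr1 (fun P : {poly int} => P.[r]) (geomE N r%:P ('X^p : {poly int})).
  by rewrite !hornerE -exprM => ->.
have E : geom (p * N) r%:P 'X
    = geom N r%:P 'X^p * geom p r%:P 'X + (r ^+ p - r)%:P * D.
  apply: (@mulfI _ ('X - r%:P)); first by rewrite polyXsubC_eq0.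
  rewrite geomE.
  have -> : ('X - r%:P) * (geom N r%:P 'X^p * geom p r%:P 'X + (r ^+ p - r)%:P * D)
    = F * (('X - r%:P) * geom p r%:P 'X) + (r ^+ p - r)%:P * (D * ('X - r%:P)).
    by rewrite -/F; ring.
  rewrite -DE geomE [_%:P * (_ - _)]mulrBr -polyCM FrE.
  have -> : F * ('X^p - r%:P ^+ p) + ((r ^+ p - r)%:P * F - (r ^+ (p * N) - r ^+ N)%:P)
      = ('X^p - r%:P) * F - (r ^+ (p * N) - r ^+ N)%:P.
    by rewrite polyCB polyC_exp; ring.
  by rewrite /F geomE !polyCB !polyC_exp exprM; ring.
exists D => y.
have geomH M (Y : {poly int}) :
    (pZtoC (geom M r%:P Y)).[y] = geom M r%:~R (pZtoC Y).[y].
  rewrite rmorph_sum horner_sum; apply: eq_bigr => i _.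
  by rewrite rmorphM !rmorphXn /= map_polyC hornerM !horner_exp hornerC.
have := congr1 (fun P => (pZtoC P).[y]) E.
rewrite rmorphD !rmorphM /= hornerD !hornerM !geomH map_polyC hornerC.
by rewrite map_polyXn map_polyX hornerXn hornerX.
Qed.

(** * Integer spans and the proposed basis *)

Definition zspan (b : seq algC) (x : algC) : Prop :=
  exists c : 'I_(size b) -> int, x = \sum_(i < size b) (c i)%:~R * b`_i.

Lemma zspan0 b : zspan b 0.
Proof. by exists (fun=> 0); rewrite big1 // => i _; rewrite mul0r. Qed.

Lemma zspanD b x y : zspan b x -> zspan b y -> zspan b (x + y).
Proof.
move=> [c ->] [d ->]; exists (fun i => c i + d i).
by rewrite -big_split; apply: eq_bigr => i _; rewrite rmorphD mulrDl.
Qed.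

Lemma zspanZ b (e : int) x : zspan b x -> zspan b (e%:~R * x).
Proof.
move=> [c ->]; exists (fun i => e * c i).
by rewrite mulr_sumr; apply: eq_bigr => i _; rewrite rmorphM mulrA.
Qed.

Lemma zspanN b x : zspan b x -> zspan b (- x).
Proof. by move=> /(zspanZ b (-1)); rewrite mulN1r. Qed.

Lemma zspan_sum b (I : Type) (s : seq I) (P : pred I) (F : I -> algC) :
  (forall i, P i -> zspan b (F i)) -> zspan b (\sum_(i <- s | P i) F i).
Proof. by apply: big_ind; [exact: zspan0 | exact: zspanD]. Qed.

Lemma zspan_mem b x : x \in b -> zspan b x.
Proof.
move=> xb; have lt_ib : (index x b < size b)%N by rewrite index_mem.
exists (fun i => (i == Ordinal lt_ib)%:R).
rewrite (bigD1 (Ordinal lt_ib)) //= eqxx mul1r nth_index // big1 ?addr0 //.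
by move=> i /negPf->; rewrite mul0r.
Qed.

Lemma zspan_subset (b : seq algC) (Q : algC -> Prop) :
  (forall x, x \in b -> Q x) -> Q 0 -> (forall x y, Q x -> Q y -> Q (x + y)) ->
  (forall (e : int) x, Q x -> Q (e%:~R * x)) -> forall x, zspan b x -> Q x.
Proof.
move=> Qb Q0 QD QZ x [c ->]; apply: big_ind => // i _.
by apply: QZ; apply: Qb; rewrite mem_nth.
Qed.

(** Gives both parts of the family one indexing: the subtracted power is dropped exactly at the last
    level [t = S]. *)
Lemma mem_basis_i (p k : nat) (r : int) (a : algC) (S : nat) (x : algC) :
  reflect (exists t j : nat, [/\ (t <= S)%N,
             (j < p ^ (k - t) - (if (t < S)%N then p ^ (k - t - 1) else 0))%N
             & x = hel p k r a t j])
    (x \in basis_i p k r a S).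
Proof.
rewrite mem_cat; apply: (iffP orP).
  case=> [/flattenP [s /mapP [t]]|/mapP [j]].
    rewrite mem_iota add0n => /= lt_tS -> /mapP [j]; rewrite mem_iota add0n => /= lt_j ->.
    by exists t, j; rewrite lt_tS (ltnW lt_tS).
  rewrite mem_iota add0n => /= lt_j ->.
  by exists S, j; rewrite leqnn ltnn subn0.
case=> t [j [le_tS lt_j ->]]; move: lt_j; case: (ltnP t S) => lt_tS lt_j; [left|right].
  apply/flattenP; exists [seq hel p k r a t j | j <- iota 0 (p ^ (k - t) - p ^ (k - t - 1))].
    by apply/mapP; exists t => //; rewrite mem_iota.
  by apply/mapP; exists j => //; rewrite mem_iota.
have tS : t = S by apply/eqP; rewrite eqn_leq le_tS.
rewrite tS subn0 in lt_j *.
by apply/mapP; exists j => //; rewrite mem_iota.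
Qed.

(** The sizes of the levels below [S] telescope to [p^k - p^(k-S)]. *)
Lemma size_basis_i (p k : nat) (r : int) (a : algC) (S : nat) :
  (0 < p)%N -> (S <= k)%N -> size (basis_i p k r a S) = (p ^ k)%N.
Proof.
move=> p_gt0; rewrite /basis_i size_cat size_map size_iota.
elim: S => [|S IH] le_Sk; first by rewrite subn0.
have -> : iota 0 S.+1 = iota 0 S ++ [:: S] by rewrite -(addn1 S) iotaD.
rewrite -(IH (ltnW le_Sk)) map_cat flatten_cat size_cat -addnA.
congr addn; rewrite /= cats0 size_map size_iota -subnDA addn1 subnK //.
by rewrite leq_pexp2l // leq_sub2l.
Qed.

(** * Nilpotence modulo [p] *)

(** Nilpotence modulo [p] in the ring of all algebraic integers, since sums over conjugates of [a]
    involve terms that may lie outside [Q(a)]. *)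
Definition nilp_mod (p : nat) (x : algC) : Prop :=
  exists M : nat, exists2 w, w \in Aint & x ^+ M = p%:R * w.

Lemma nilp_modD p x y : x \in Aint -> y \in Aint ->
  nilp_mod p x -> nilp_mod p y -> nilp_mod p (x + y).
Proof.
move=> xA yA [M [v vA xE]] [N [w wA yE]]; exists (M + N)%N; rewrite exprDn.
have [f fP] : exists f : 'I_(M + N).+1 -> algC, forall i : 'I_(M + N).+1,
    f i \in Aint /\ x ^+ (M + N - i) * y ^+ i *+ 'C(M + N, i) = p%:R * f i.
  apply: (fin_all_exists (P := fun (i : 'I_(M + N).+1) v => v \in Aint /\
    x ^+ (M + N - i) * y ^+ i *+ 'C(M + N, i) = p%:R * v)) => i.
  have [leNi|ltiN] := leqP N i.
    exists (x ^+ (M + N - i) * w * y ^+ (i - N) *+ 'C(M + N, i)).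
    split; first by rewrite rpredMn // !rpredM // rpredX.
    have -> : y ^+ i = p%:R * w * y ^+ (i - N) by rewrite -yE -exprD subnKC.
    by rewrite -mulr_natr -[in RHS]mulr_natr; ring.
  exists (x ^+ (N - i) * v * y ^+ i *+ 'C(M + N, i)).
  split; first by rewrite rpredMn // !rpredM // rpredX.
  by rewrite -addnBA ?(ltnW ltiN) // exprD xE -mulr_natr -[in RHS]mulr_natr; ring.
exists (\sum_i f i); first by rewrite rpred_sum // => i _; case: (fP i).
by rewrite mulr_sumr; apply: eq_bigr => i _; case: (fP i).
Qed.

Lemma nilp_mod_mulp p x : x \in Aint -> nilp_mod p (p%:R * x).
Proof. by move=> xA; exists 1%N, x. Qed.

Lemma nilp_mod_sum p (I : Type) (s : seq I) (P : pred I) (F : I -> algC) :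
  (forall i, P i -> F i \in Aint) -> (forall i, P i -> nilp_mod p (F i)) ->
  nilp_mod p (\sum_(i <- s | P i) F i).
Proof.
move=> FA FN; suff [] : \sum_(i <- s | P i) F i \in Aint /\
    nilp_mod p (\sum_(i <- s | P i) F i) by [].
apply: (big_ind (fun x => x \in Aint /\ nilp_mod p x)).
- by split; [exact: rpred0 | rewrite -(mulr0 p%:R); exact: nilp_mod_mulp].
- by move=> x y [xA xN] [yA yN]; split; [exact: rpredD | exact: nilp_modD].
by move=> i Pi; split; [exact: FA | exact: FN].
Qed.

Lemma prime_dvdzX (p : nat) (c : int) (M : nat) :
  prime p -> (p%:Z %| c ^+ M)%Z -> (p%:Z %| c)%Z.
Proof. by move=> p_pr; rewrite !dvdzE abszX /= Euclid_dvdX // => /andP[]. Qed.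

Lemma prime_dvdzM (p : nat) (c d : int) :
  prime p -> (p%:Z %| c * d)%Z = (p%:Z %| c)%Z || (p%:Z %| d)%Z.
Proof. by move=> p_pr; rewrite !dvdzE abszM Euclid_dvdM. Qed.

(** The quotient [c^M / p] is a rational algebraic integer, hence an integer. *)
Lemma nilp_mod_int (p : nat) (c : int) :
  prime p -> nilp_mod p c%:~R -> (p%:Z %| c)%Z.
Proof.
move=> p_pr [M [w wA cE]]; apply: (@prime_dvdzX _ _ M) => //.
have p0 : p%:R != 0 :> algC by rewrite pnatr_eq0 -lt0n prime_gt0.
have wE : w = ratr (c%:~R ^+ M / p%:R).
  by rewrite rmorphM fmorphV /= rmorphXn rmorph_int rmorph_nat /= cE mulrC mulKf.
have /intrP [d dE] : w \in Num.int.
  by apply: Cint_rat_Aint => //; rewrite wE Crat_rat.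
have -> : c ^+ M = p%:Z * d.
  by apply: (intr_inj (R := algC)); rewrite rmorphM rmorphXn /= cE dE -pmulrn.
exact: dvdz_mulr.
Qed.

Lemma zspan_bezout (b : seq algC) (c d : int) (x : algC) :
  coprimez c d -> zspan b (c%:~R * x) -> zspan b (d%:~R * x) -> zspan b x.
Proof.
move=> /coprimezP [[u v] /= uvE] cx dx.
have -> : x = u%:~R * (c%:~R * x) + v%:~R * (d%:~R * x).
  by rewrite !mulrA -mulrDl -!rmorphM -rmorphD uvE mul1r.
by apply: zspanD; apply: zspanZ.
Qed.

(** * The span of the proposed basis *)

Section PurePrimePower.

Variables (p k S : nat) (m r : int) (a : algC).
Hypotheses (m_sqf : squarefree_int m) (m_neq1 : m != 1) (m_neqN1 : m != -1).
Hypotheses (p_pr : prime p) (anE : a ^+ (p ^ k) = m%:~R) (leSk : (S <= k)%N).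
Hypothesis r_coprime : ~~ (p%:Z %| r)%Z.
Hypothesis r_frob : (p%:Z ^+ S.+1 %| r ^+ p - r)%Z.
Hypothesis r_approx :
  forall t : nat, (t <= S)%N -> (p%:Z ^+ t.+1 %| m - r ^+ (p ^ t))%Z.

Let n := (p ^ k)%N.
Let rC : algC := r%:~R.
(** The root [b] is a parameter because traces evaluate these elements at the conjugates [z^i * a]
    as well as at [a]. *)
Let g (b : algC) (t : nat) : algC := b ^+ (p ^ (k - t)).
Let beta_at (b : algC) (t : nat) : algC := geom (p ^ t) rC (g b t) / (p ^ t)%:R.
Let beta := beta_at a.
Let inB := zspan (basis_i p k r a S).

Let p_gt0 : (0 < p)%N. Proof. exact: prime_gt0. Qed.
Let pt_gt0 t : (0 < p ^ t)%N. Proof. by rewrite expn_gt0 p_gt0. Qed.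
Let n_gt0 : (0 < n)%N. Proof. exact: pt_gt0. Qed.
Let pt_neq0 t : (p ^ t)%:R != 0 :> algC. Proof. by rewrite pnatr_eq0 -lt0n. Qed.
Let pC_neq0 : p%:R != 0 :> algC. Proof. by rewrite pnatr_eq0 -lt0n. Qed.

Lemma radical_Aint : a \in Aint.
Proof. exact: (@Aint_radical m n n_gt0 a anE). Qed.

Let beta0 b : beta_at b 0 = 1.
Proof. by rewrite /beta_at expn0 /geom big_ord1 expr0 mulr1 divr1. Qed.

Lemma hel_beta t j : (t <= k)%N -> hel p k r a t j = a ^+ j * beta t.
Proof.
move=> le_tk; rewrite /hel /beta /beta_at mulrA; congr (_ * _ / _).
rewrite /hpoly rmorph_sum horner_sum; apply: eq_bigr => i _.
rewrite rmorphM /= map_polyC map_polyXn hornerM hornerXn hornerC mulrC /= rmorphXn /=.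
congr (_ * _); rewrite /g -exprM; congr (_ ^+ _).
by rewrite -subn1 -subnDA add1n mulnBr -expnD subnK // mulnC.
Qed.

(** The product is [(g_t^(p^t) - r^(p^t)) / p^t = (m - r^(p^t)) / p^t], and [r_approx] provides one
    factor [p] beyond [p^t]. *)
Lemma beta_level t : (t <= S)%N ->
  exists2 L : int, (p%:Z %| L)%Z &
    (g a t - rC) * beta t = L%:~R /\ m - r ^+ (p ^ t) = (p ^ t)%:Z * L.
Proof.
move=> le_tS; have /dvdzP [q qE] := r_approx t le_tS.
exists (p%:Z * q); first exact: dvdz_mulr.
have LE : m - r ^+ (p ^ t) = (p ^ t)%:Z * (p%:Z * q).
  by rewrite qE exprSr -(natz (p ^ t)) natrX natz; ring.
split=> //; rewrite /beta /beta_at mulrA geomE /g -exprM -expnD subnK ?(leq_trans le_tS) //.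
rewrite anE -rmorphXn -rmorphB LE /= rmorphM /= -pmulrn mulrC mulKf //.
Qed.

Lemma beta_Aint t : (t <= S)%N -> beta t \in Aint.
Proof.
move=> le_tS; have [L pL [LE _]] := beta_level t le_tS.
exact: Aint_geom_div LE.
Qed.

(** This is [geom_step] with [N = p^t] at [y = g_(t+1)], where [y^p = g_t]. Since [p^(t+1)] divides
    [r^p - r], a factor [p] remains after division by [p^t]. *)
Lemma beta_step t : (t < S)%N -> exists (c : int) (D : {poly int}),
  p%:R * beta t.+1
  = geom p rC (g a t.+1) * beta t + p%:R * c%:~R * (pZtoC D).[g a t.+1].
Proof.
move=> lt_tS; have [D DE] := geom_step p (p ^ t) r.
have /dvdzP [c cE] : (p%:Z ^+ t.+1 %| r ^+ p - r)%Z.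
  by apply: dvdz_trans r_frob; rewrite dvdz_exp2l // ltnW.
exists c, D; apply: (mulfI (pt_neq0 t)); rewrite /beta /beta_at.
have gp : g a t = g a t.+1 ^+ p.
  rewrite /g -exprM -expnSr subnSK //; apply: leq_trans leSk; exact: lt_tS.
have -> : (p ^ t)%:R * (p%:R * (geom (p ^ t.+1) rC (g a t.+1) / (p ^ t.+1)%:R))
    = geom (p * p ^ t) rC (g a t.+1).
  rewrite expnS natrM; field; by rewrite ?natrX ?expf_neq0 ?pC_neq0.
rewrite DE -gp cE rmorphM rmorphXn /= exprS -pmulrn natrX.
by field; rewrite expf_neq0.
Qed.

Let inBD x y : inB x -> inB y -> inB (x + y). Proof. exact: zspanD. Qed.
Let inBZ (e : int) x : inB x -> inB (e%:~R * x). Proof. exact: zspanZ. Qed.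
Let inBB x y : inB x -> inB y -> inB (x - y).
Proof. by move=> Bx By; apply: inBD => //; apply: zspanN. Qed.
Let inBnat (e : nat) x : inB x -> inB (e%:R * x).
Proof. by rewrite pmulrn; exact: inBZ. Qed.

Let width t := (p ^ (k - t) - (if (t < S)%N then p ^ (k - t - 1) else 0))%N.

Lemma width_gt0 t : (t <= S)%N -> (0 < width t)%N.
Proof.
move=> le_tS; rewrite /width subn_gt0; case: ifP => // lt_tS.
by rewrite ltn_exp2l ?prime_gt1 // subn1 ltn_predL subn_gt0 (leq_trans lt_tS).
Qed.

Lemma basis_span_hel t j : (t <= S)%N -> (j < width t)%N -> inB (a ^+ j * beta t).
Proof.
move=> le_tS lt_j; apply: zspan_mem; apply/mem_basis_i; exists t, j; split=> //.
by rewrite hel_beta ?(leq_trans le_tS).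
Qed.

Lemma basis_span_beta t : (t <= S)%N -> inB (beta t).
Proof. by move=> le_tS; rewrite -[beta t]mul1r; apply: (basis_span_hel t 0); rewrite ?width_gt0. Qed.

Lemma geom_lead N (y : algC) : (0 < N)%N ->
  geom N rC y = y ^+ N.-1 + \sum_(i < N.-1) rC ^+ i.+1 * y ^+ (N.-1 - i.+1).
Proof.
case: N => // N _; rewrite /geom big_ord_recl subn0 expr0 mulr1 /=; congr (_ + _).
by apply: eq_bigr => i _; rewrite mulrC.
Qed.

(** The polynomial behind [a^j * beta t] has degree [p^k - p^(k-t) + j], so this says that the
    levels tile the degrees below [n]. Raising [S] by one splits the last block in two. *)
Lemma block_index d : (d < n)%N -> exists t j,
  [/\ (t <= S)%N, (j < width t)%N & d = (p ^ k - p ^ (k - t) + j)%N].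
Proof.
rewrite /n /width => lt_dn; elim: S leSk => [|T IH] leTk.
  by exists 0%N, d; rewrite !subn0 subnn.
have [t [j [le_tT lt_j dE]]] := IH (ltnW leTk).
have [lt_tT|ge_tT] := ltnP t T.
  by exists t, j; move: lt_j; rewrite lt_tT (leqW le_tT) ltnS le_tT.
have tT : t = T by apply/eqP; rewrite eqn_leq le_tT.
move: lt_j dE; rewrite tT ltnn subn0 => lt_j dE.
have [lt_jw|ge_jw] := ltnP j (p ^ (k - T) - p ^ (k - T - 1)).
  by exists T, j; rewrite leqnSn ltnSn.
have le1 : (p ^ (k - T - 1) <= p ^ (k - T))%N by rewrite leq_pexp2l // leq_subr.
have le2 : (p ^ (k - T) <= p ^ k)%N by rewrite leq_pexp2l // leq_subr.
exists T.+1, (j - (p ^ (k - T) - p ^ (k - T - 1)))%N; rewrite ltnn leqnn subn0.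
have -> : (k - T.+1 = k - T - 1)%N by rewrite subn1 subnS.
move: lt_j dE ge_jw le1 le2.
move: (p ^ (k - T - 1))%N (p ^ (k - T))%N (p ^ k)%N => A B C lt_j dE ge_jw le1 le2.
by split=> //; lia.
Qed.

(** After reduction of the exponent by [a^n = m], the multiple [p^t] of the basis element of degree
    [d] is [a^d] plus an integer combination of lower powers; induction on [d] applies. *)
Lemma basis_span_pow d : inB (a ^+ d).
Proof.
rewrite (divn_eq d n) exprD mulnC exprM anE -rmorphXn; apply: inBZ.
have : (d %% n < n)%N by rewrite ltn_mod.
elim/ltn_ind: (d %% n)%N => {}d IH lt_dn.
have [t [j [le_tS lt_j dE]]] := block_index d lt_dn.
have le_tk := leq_trans le_tS leSk.
have pk : (p ^ k = p ^ (k - t) * p ^ t)%N by rewrite -expnD subnK.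
have -> : a ^+ d = (p ^ t)%:R * (a ^+ j * beta t)
    - \sum_(i < (p ^ t).-1) (r ^+ i.+1)%:~R * a ^+ (j + p ^ (k - t) * ((p ^ t).-1 - i.+1)).
  have -> : (p ^ t)%:R * (a ^+ j * beta t) = a ^+ j * geom (p ^ t) rC (g a t).
    by rewrite /beta /beta_at; field; rewrite natrX expf_neq0.
  rewrite geom_lead // mulrDr mulr_sumr.
  have -> : a ^+ j * g a t ^+ (p ^ t).-1 = a ^+ d.
    rewrite /g -exprM -exprD dE pk addnC -subn1 mulnBr muln1.
    by [].
  rewrite -[LHS]addr0 -addrA; congr (_ + _); apply/esym/eqP; rewrite subr_eq0.
  by apply/eqP/eq_bigr => i _; rewrite rmorphXn /= exprD exprM -/(g a t); ring.
apply: inBB; first by apply: inBnat; exact: basis_span_hel.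
apply: zspan_sum => i _; apply: inBZ.
have lt_d : (j + p ^ (k - t) * ((p ^ t).-1 - i.+1) < d)%N.
  rewrite dE pk; have := ltn_ord i; have := pt_gt0 (k - t); have := pt_gt0 t.
  move: (p ^ (k - t))%N (p ^ t)%N (i : nat) => A B l B0 A0 lt_l.
  have BE : B = (B.-1 - l.+1 + l.+1 + 1)%N by lia.
  rewrite {2}BE !mulnDr muln1 addnK addnC ltn_add2r -[ltnLHS]addn0 ltn_add2l.
  by rewrite muln_gt0 A0.
by apply: IH => //; exact: ltn_trans lt_dn.
Qed.

Lemma basis_span_poly (P : {poly int}) : inB (pZtoC P).[a].
Proof.
rewrite horner_coef; apply: zspan_sum => i _; rewrite coef_map; apply: inBZ.
exact: basis_span_pow.
Qed.

Let g_poly (D : {poly int}) t :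
  (pZtoC D).[g a t] = (pZtoC (D \Po 'X^(p ^ (k - t)))).[a].
Proof. by rewrite map_comp_poly horner_comp map_polyXn hornerXn. Qed.

(** Only the last [j] of a level leaves its block. At [t = S], [beta_level] gives
    [g_S beta_S = L + r beta_S]; below [S], [beta_step] is solved for its leading term. *)
Lemma basis_span_mula x : inB x -> inB (a * x).
Proof.
apply: (@zspan_subset _ (fun x => inB (a * x))); last 1 first.
- by move=> e y By; rewrite mulrCA; exact: inBZ.
- move=> y /mem_basis_i [t [j [le_tS lt_j ->]]].
  rewrite hel_beta ?(leq_trans le_tS) // mulrA -exprS.
  have [lt_jw|ge_jw] := ltnP j.+1 (width t); first exact: basis_span_hel.
  have {lt_j ge_jw} jw : j.+1 = width t by apply/eqP; rewrite eqn_leq lt_j.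
  have [lt_tS|ge_tS] := ltnP t S; last first.
    have tS : t = S by apply/eqP; rewrite eqn_leq le_tS.
    have [L _ [LE _]] := beta_level t le_tS.
    rewrite jw /width tS ltnn subn0.
    have -> : a ^+ (p ^ (k - S)) * beta S = L%:~R * a ^+ 0 + r%:~R * beta S.
      by rewrite expr0 mulr1 -LE tS /g /rC; ring.
    by apply: inBD; apply: inBZ; [exact: basis_span_pow | exact: basis_span_beta].
  have [c [D stepE]] := beta_step t lt_tS.
  have ktE : (k - t = (k - t.+1).+1)%N by rewrite subnSK // (leq_trans lt_tS).
  (* Hence [a^(width t)] is [g_(t+1)^(p-1)], the leading term of the geometric sum in
     [beta_step]. *)
  have wE : width t = (p ^ (k - t.+1) * p.-1)%N.
    by rewrite /width lt_tS ktE subn1 /= expnS -subn1 mulnBr muln1 mulnC.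
  have -> : a ^+ j.+1 * beta t = p%:R * beta t.+1 - (p%:Z * c)%:~R * (pZtoC D).[g a t.+1]
     - \sum_(i < p.-1) (r ^+ i.+1)%:~R * (a ^+ (p ^ (k - t.+1) * (p.-1 - i.+1)) * beta t).
    rewrite stepE rmorphM /= -pmulrn addrK geom_lead // mulrDl mulr_suml jw wE exprM.
    rewrite -/(g a t.+1) -[LHS]addr0 -[RHS]addrA; congr (_ + _).
    apply/esym/eqP; rewrite subr_eq0; apply/eqP/eq_bigr => i _.
    by rewrite rmorphXn /= exprM -/(g a t.+1) -[LHS]mulrA.
  apply: inBB; first apply: inBB.
  - by apply: inBnat; apply: basis_span_beta.
  - by apply: inBZ; rewrite g_poly; exact: basis_span_poly.
  apply: zspan_sum => i _; apply: inBZ; apply: basis_span_hel => //.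
  by rewrite wE ltn_pmul2l // ltn_subrL /=; rewrite (leq_ltn_trans _ (ltn_ord i)).
- by rewrite mulr0; exact: zspan0.
by move=> y z By Bz; rewrite mulrDr; exact: inBD.
Qed.

Lemma basis_span_mulpoly (P : {poly int}) x : inB x -> inB ((pZtoC P).[a] * x).
Proof.
move=> Bx; rewrite horner_coef mulr_suml; apply: zspan_sum => i _.
rewrite coef_map -mulrA; apply: inBZ; elim: (i : nat) => [|e IH].
  by rewrite expr0 mul1r.
by rewrite exprS -mulrA; exact: basis_span_mula.
Qed.

Let u := a - rC.

Lemma basis_span_mulu x : inB x -> inB (u * x).
Proof.
by move=> Bx; rewrite mulrBl; apply: inBB; [exact: basis_span_mula | exact: inBZ].
Qed.

Lemma poly_mod_u (P : {poly int}) :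
  exists Q : {poly int}, (pZtoC P).[a] = (P.[r])%:~R + u * (pZtoC Q).[a].
Proof.
have /factor_theorem [Q QE] : root (P - P.[r]%:P) r.
  by rewrite /root !hornerE subrr.
exists Q; have := congr1 (fun T => (pZtoC T).[a]) QE.
rewrite rmorphB rmorphM /= rmorphB /= !map_polyC map_polyX !hornerE /= => E.
by rewrite -[LHS](subrK (P.[r])%:~R) E /u; ring.
Qed.

(** Modulo [u] the factor [a^j] may be replaced by the integer [r^j]. *)
Lemma basis_span_mod_u x : inB x -> exists (e : nat -> int) (y : algC),
  inB y /\ x = \sum_(t < S.+1) (e t)%:~R * beta t + u * y.
Proof.
apply: (@zspan_subset _ (fun x => exists (e : nat -> int) (y : algC),
  inB y /\ x = \sum_(t < S.+1) (e t)%:~R * beta t + u * y)).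
- move=> z /mem_basis_i [t [j [le_tS lt_j ->]]].
  rewrite hel_beta ?(leq_trans le_tS) //.
  have [Q QE] := poly_mod_u 'X^j.
  exists (fun i => if i == t then r ^+ j else 0), ((pZtoC Q).[a] * beta t).
  split; first by apply: basis_span_mulpoly; exact: basis_span_beta.
  rewrite (bigD1 (Ordinal (le_tS : (t < S.+1)%N))) //= eqxx big1 ?addr0.
    by move: QE; rewrite map_polyXn !hornerXn => ->; ring.
  by move=> i; rewrite -val_eqE /= => /negPf->; rewrite mul0r.
- exists (fun=> 0), 0; split; first exact: zspan0.
  by rewrite mulr0 addr0 big1 // => i _; rewrite mul0r.
- move=> x1 x2 [e1 [y1 [By1 ->]]] [e2 [y2 [By2 ->]]].
  exists (fun t => e1 t + e2 t), (y1 + y2); split; first exact: inBD.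
  under [in RHS]eq_bigr do rewrite rmorphD mulrDl.
  by rewrite big_split /=; ring.
move=> c x1 [e1 [y1 [By1 ->]]]; exists (fun t => c * e1 t), (c%:~R * y1).
split; first exact: inBZ.
under [in RHS]eq_bigr do rewrite rmorphM -mulrA.
by rewrite -mulr_sumr; ring.
Qed.

(** Induction along [beta_step]: modulo [u], its geometric sum becomes an integer [p q], because a
    [p]-power power of [r] is congruent to [r] modulo [p]. So [p beta_(t+1)] reduces to
    [q (p beta_t)] plus a multiple of [p]. *)
Lemma p_beta_mod_u t : (t <= S)%N -> exists (c : int) (y : algC),
  inB y /\ p%:R * beta t = p%:R * c%:~R + u * y.
Proof.
elim: t => [|t IH] lt_tS.
  exists 1, 0; split; first exact: zspan0.
  by rewrite /beta beta0; ring.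
have [c [y [By bE]]] := IH (ltnW lt_tS); have [d [D stepE]] := beta_step t lt_tS.
pose G := geom p r%:P ('X^(p ^ (k - t.+1)) : {poly int}).
have [Q QE] := poly_mod_u G; have [Q' QE'] := poly_mod_u (D \Po 'X^(p ^ (k - t.+1))).
have Ga : (pZtoC G).[a] = geom p rC (g a t.+1).
  rewrite rmorph_sum horner_sum; apply: eq_bigr => i _.
  by rewrite rmorphM !rmorphXn /= map_polyC map_polyX !hornerE.
have /dvdzP [q qE] : (p%:Z %| G.[r])%Z.
  rewrite /G /geom horner_sum.
  rewrite (eq_bigr (fun i : 'I_p => (r ^+ (p ^ (k - t.+1))) ^+ (p.-1 - i) * r ^+ i)).
    apply: dvdz_geom; have := @dvdz_exp_sub p 1 (k - t.+1) r.
    by rewrite expr1; apply; exact: prime_dvdz_fermat.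
  by move=> i _; rewrite !hornerE.
exists (q * c + d * (D \Po 'X^(p ^ (k - t.+1))).[r]),
  (q%:~R * y + (pZtoC Q).[a] * beta t + (p%:Z * d)%:~R * (pZtoC Q').[a]); split.
  apply: inBD; first apply: inBD.
  - exact: inBZ.
  - by apply: basis_span_mulpoly; apply: basis_span_beta; exact: ltnW.
  by apply: inBZ; exact: basis_span_poly.
rewrite stepE -Ga g_poly QE QE' qE !rmorphD !rmorphM /= -!pmulrn.
set X := (pZtoC Q).[a]; set Y := (pZtoC Q').[a]; set Z := (D \Po _).[r]%:~R.
transitivity (q%:~R * (p%:R * beta t) + u * X * beta t + p%:R * d%:~R * (Z + u * Y)).
  by ring.
by rewrite bE; ring.
Qed.

(** * Nilpotence of [u] and traces of the [beta t] *)

Lemma intpoly_dvd_of_Fp_eq0 (P : {poly int}) :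
  map_poly (intr : int -> 'F_p) P = 0 -> exists Q : {poly int}, P = p%:Z *: Q.
Proof.
move=> P0; exists (\poly_(i < size P) (P`_i %/ p)%Z); apply/polyP => i.
rewrite coefZ coef_poly; case: ltnP => [_|le_i]; last by rewrite nth_default ?mulr0.
have: (p%:Z %| P`_i)%Z.
  by rewrite (dvdz_pcharf (pchar_Fp p_pr)) -coef_map P0 coef0.
by move/divzK; rewrite mulrC.
Qed.

Lemma p_dvd_sub_r_pow : (p%:Z %| m - r ^+ n)%Z.
Proof.
have := r_approx 0 (leq0n S); rewrite expn0 expr1 => pmr.
rewrite -(subrKA r) rpredD // -opprB rpredN.
have := @dvdz_exp_sub p 1 k r; rewrite expr1; apply.
exact: prime_dvdz_fermat.
Qed.

(** Frobenius gives [(X - r)^n = X^n - r^n] modulo [p], and at [a] the right side is [m - r^n], a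
    multiple of [p]. *)
Lemma u_pow : exists Q : {poly int}, u ^+ n = p%:R * (pZtoC Q).[a].
Proof.
pose P : {poly int} := ('X - r%:P) ^+ n - ('X^n - (r ^+ n)%:P).
have [Q QE] : exists Q : {poly int}, P = p%:Z *: Q.
  have pn : [pchar {poly 'F_p}].-nat n.
    apply/pnatP => // q q_pr; rewrite Euclid_dvdX // => /andP[qp _].
    rewrite pchar_poly; move: qp; rewrite dvdn_prime2 // => /eqP->.
    exact: pchar_Fp.
  apply: intpoly_dvd_of_Fp_eq0; rewrite !rmorphB rmorphXn rmorphB /= map_polyX.
  rewrite map_polyXn !map_polyC /= rmorphXn /= exprDn_pchar // exprNn_pchar //.
  by rewrite -polyC_exp subrr.
have /dvdzP [q qE] := p_dvd_sub_r_pow.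
exists (Q + q%:P); have := congr1 (fun T => (pZtoC T).[a]) QE.
rewrite !rmorphB rmorphXn rmorphB rmorphD /= map_polyX map_polyXn !map_polyC.
rewrite map_polyZ /= !hornerE anE => E.
rewrite -[LHS](subrK (m%:~R - (r ^+ n)%:~R)) E -rmorphB qE rmorphM /= -!pmulrn.
by ring.
Qed.

Let beta_pol t : {poly rat} := (p ^ t)%:R^-1 *: geom (p ^ t) r%:~R%:P ('X^(p ^ (k - t))).

Lemma beta_polE b t : (pQtoC (beta_pol t)).[b] = beta_at b t.
Proof.
rewrite /beta_pol map_polyZ hornerZ /= fmorphV rmorph_nat mulrC /beta_at.
congr (_ / _); rewrite rmorph_sum horner_sum; apply: eq_bigr => i _.
by rewrite rmorphM !rmorphXn /= map_polyC map_polyX !hornerE /= rmorph_int.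
Qed.

(** Integrality of [G^M / p] passes from [a] to [b] by [Aint_conjugate]. *)
Lemma nilp_mod_conj (G : {poly rat}) (b : algC) : b ^+ n = m%:~R ->
  nilp_mod p (pQtoC G).[a] -> nilp_mod p (pQtoC G).[b].
Proof.
move=> bn [M [w wA wE]]; pose H := p%:R^-1 *: G ^+ M.
have HE c : (pQtoC G).[c] ^+ M = p%:R * (pQtoC H).[c].
  by rewrite /H map_polyZ hornerZ /= fmorphV rmorph_nat mulVKf // rmorphXn horner_exp.
exists M, (pQtoC H).[b] => //; apply: (@Aint_conjugate m n a) => //.
by move: wE; rewrite HE => /(mulfI pC_neq0) ->.
Qed.

(* Sum over the conjugates [z^i a], [i < p^v]: the term of index [t]
   contributes [p^(v-t) e_t r^(p^t-1)], a multiple of [p] unless [t = v]. *)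
Lemma nilp_mod_last (v : nat) (e : nat -> int) : (v <= S)%N ->
  nilp_mod p (\sum_(t < v.+1) (e t)%:~R * beta t) -> (p%:Z %| e v)%Z.
Proof.
move=> le_vS Nz; have [z z_prim] := C_prim_root_exists n_gt0.
have zn : z ^+ n = 1 := prim_expr_order z_prim.
pose G : {poly rat} := \sum_(t < v.+1) (e t)%:~R *: beta_pol t.
have GE b : (pQtoC G).[b] = \sum_(t < v.+1) (e t)%:~R * beta_at b t.
  rewrite /G rmorph_sum horner_sum; apply: eq_bigr => t _.
  by rewrite /= map_polyZ hornerZ beta_polE /= rmorph_int.
have conj_n i : (z ^+ i * a) ^+ n = m%:~R by rewrite exprMn exprAC zn expr1n mul1r.
(* As [w] is a primitive [p^t]-th root of unity and [p^t] divides [p^v], summing over [i] kills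
   every positive power of [g] and leaves the constant term. *)
have trace_beta t : (t <= v)%N ->
    \sum_(i < p ^ v) beta_at (z ^+ i * a) t = (p ^ (v - t) * 1)%:R * rC ^+ (p ^ t).-1.
  move=> le_tv; have le_tk : (t <= k)%N by exact: leq_trans (leq_trans le_tv le_vS) leSk.
  pose w := z ^+ (p ^ (k - t)).
  have w_prim : (p ^ t).-primitive_root w.
    have := dvdn_prim_root z_prim (dvdn_exp2l p le_tk).
    rewrite /w; suff -> : (n %/ p ^ t = p ^ (k - t))%N by [].
    by rewrite /n -{1}(subnK le_tk) expnD mulnK.
  transitivity ((\sum_(l < p ^ t) g a t ^+ ((p ^ t).-1 - l) * rC ^+ l *
      \sum_(i < p ^ v) (w ^+ ((p ^ t).-1 - l)) ^+ i) / (p ^ t)%:R).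
    rewrite /beta_at -mulr_suml; congr (_ / _); rewrite exchange_big /=.
    apply: eq_bigr => l _; rewrite mulr_sumr; apply: eq_bigr => i _.
    rewrite /g /w !exprMn -!exprM.
    rewrite mulnC -mulnA.
    by rewrite -[LHS]mulrA mulrC.
  have lt_last : ((p ^ t).-1 < p ^ t)%N by rewrite prednK.
  rewrite (bigD1 (Ordinal lt_last)) //= subnn expr0 mul1r [X in _ + X]big1 ?addr0.
    under eq_bigr do rewrite expr0 expr1n.
    rewrite sumr_const card_ord muln1 -(subnK le_tv) expnD natrM addnK.
    by field; rewrite natrX expf_neq0.
  move=> l; rewrite -val_eqE /= => neq_l.
  have w1 : w ^+ ((p ^ t).-1 - l) != 1.
    rewrite -(prim_order_dvd w_prim); apply/negP => /dvdn_leq.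
    have := ltn_ord l; have := pt_gt0 t; move: neq_l.
    by move: (p ^ t)%N (l : nat) => A B; lia.
  have := subrX1 (w ^+ ((p ^ t).-1 - l)) (p ^ v).
  have -> : (w ^+ ((p ^ t).-1 - l)) ^+ (p ^ v) = 1.
    rewrite exprAC -{1}(subnK le_tv) expnD mulnC exprM (prim_expr_order w_prim).
    by rewrite !expr1n.
  rewrite subrr => /esym/eqP.
  by rewrite mulf_eq0 subr_eq0 (negPf w1) => /eqP->; rewrite mulr0.
have : nilp_mod p (\sum_(i < p ^ v) (pQtoC G).[z ^+ i * a]).
  apply: nilp_mod_sum => i _.
    apply: (@Aint_conjugate m n a) => //; rewrite GE rpred_sum // => t _.
    by rewrite rpredM ?Aint_int // beta_Aint // (leq_trans _ le_vS) // -ltnS.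
  by apply: nilp_mod_conj; rewrite // GE.
under eq_bigr do rewrite GE.
rewrite exchange_big /= (eq_bigr (fun t : 'I_v.+1 =>
  (e t * (p ^ (v - t))%:Z * r ^+ (p ^ t).-1)%:~R)); last first.
  move=> t _; rewrite -mulr_sumr.
  have le_tv : (t <= v)%N by rewrite -ltnS.
  rewrite (trace_beta _ le_tv) muln1.
  by rewrite !rmorphM rmorphXn /= -pmulrn mulrA.
rewrite -rmorph_sum => /(nilp_mod_int _ _ p_pr).
rewrite big_ord_recr /= subnn expn0 mulr1 rpredDl; last first.
  apply: rpred_sum => t _; rewrite dvdz_mulr // dvdz_mull //.
  by rewrite dvdzE /= -(subnSK (ltn_ord t)) expnS dvdn_mulr.
rewrite prime_dvdzM // => /orP[//|/(prime_dvdzX _ _ _ p_pr) pr].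
by move: r_coprime; rewrite pr.
Qed.

(** Descent on [v]: once [p] divides the top coefficient, its term is [p] times an integer and can
    be removed without losing nilpotence. *)
Lemma nilp_mod_coefs (v : nat) (e : nat -> int) : (v <= S)%N ->
  nilp_mod p (\sum_(t < v.+1) (e t)%:~R * beta t) ->
  forall t, (t <= v)%N -> (p%:Z %| e t)%Z.
Proof.
elim: v => [|v IH] le_vS Nz t le_tv.
  have := nilp_mod_last 0 e le_vS Nz.
  by move: le_tv; rewrite leqn0 => /eqP->.
have pe := nilp_mod_last _ _ le_vS Nz.
have [->//|neq_t] := eqVneq t v.+1.
apply: IH; rewrite ?(ltnW le_vS) //; last by rewrite -ltnS ltn_neqAle neq_t.
have -> : \sum_(t < v.+1) (e t)%:~R * beta t
    = \sum_(t < v.+2) (e t)%:~R * beta t + - (e v.+1)%:~R * beta v.+1.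
  by rewrite [in RHS]big_ord_recr /= mulNr addrK.
have /dvdzP [q qE] := pe; apply: nilp_modD => //.
- rewrite rpred_sum // => i _; rewrite rpredM ?Aint_int // beta_Aint //.
  by rewrite (leq_trans _ le_vS) // -ltnS.
- by rewrite rpredM ?rpredN ?Aint_int // beta_Aint.
have -> : - (e v.+1)%:~R * beta v.+1 = p%:R * (- q%:~R * beta v.+1).
  by rewrite qE rmorphM /= -pmulrn; ring.
by apply: nilp_mod_mulp; rewrite rpredM ?rpredN ?Aint_int // beta_Aint.
Qed.

Lemma basis_span_Aint x : inB x -> x \in Aint.
Proof.
apply: (@zspan_subset _ (fun x => x \in Aint)).
- move=> y /mem_basis_i [t [j [le_tS _ ->]]].
  by rewrite hel_beta ?(leq_trans le_tS) // rpredM ?rpredX ?radical_Aint ?beta_Aint.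
- exact: rpred0.
- by move=> y z; exact: rpredD.
by move=> e y yA; rewrite rpredM ?Aint_int.
Qed.

Lemma basis_ring_of_integers x :
  x \in basis_i p k r a S -> in_ring_of_integers a x.
Proof.
move=> xb; split; last by apply: basis_span_Aint; exact: zspan_mem.
have /mem_basis_i [t [j [le_tS _ ->]]] := xb.
rewrite hel_beta ?(leq_trans le_tS) //; exists ('X^j * beta_pol t).
by rewrite rmorphM /= map_polyXn hornerM hornerXn beta_polE.
Qed.

(** * Saturation of the span in the ring of integers *)

Hypothesis k_gt0 : (0 < k)%N.

Let u_neq0 : u != 0.
Proof.
apply/negP => /eqP u0; have : root (pQtoC ('X - r%:~R%:P)) a.
  by rewrite rmorphB /= map_polyX map_polyC /= rmorph_int /root !hornerE -/rC -/u u0.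
move/(@radical_min_size m n a m_sqf m_neq1 m_neqN1 n_gt0 anE).
rewrite polyXsubC_eq0 size_XsubC => /(_ isT); rewrite ltnNge => /negP; apply.
by apply: leq_trans (prime_gt1 p_pr) _; rewrite -{1}(expn1 p) leq_pexp2l.
Qed.

Lemma sum_p_beta_mod_u (e : nat -> int) : exists (c : int) (y : algC),
  inB y /\ \sum_(t < S.+1) (e t)%:~R * (p%:R * beta t) = p%:R * c%:~R + u * y.
Proof.
apply: (big_ind (fun z => exists (c : int) (y : algC),
  inB y /\ z = p%:R * c%:~R + u * y)).
- by exists 0, 0; split; [exact: zspan0 | ring].
- move=> _ _ [c [y [By ->]]] [d [z [Bz ->]]]; exists (c + d), (y + z).
  by split; [exact: inBD | rewrite rmorphD; ring].
move=> t _; have [c [y [By ->]]] := p_beta_mod_u t (ltn_ord t).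
exists (e t * c), ((e t)%:~R * y); split; first exact: inBZ.
by rewrite rmorphM; ring.
Qed.

Hypothesis r_exact : (S < k)%N ->
  forall j : nat, (0 < j)%N -> ~~ (p%:Z ^+ S.+2 %| m - r ^+ (p ^ j))%Z.

(** By [r_exact], [L = (g_S - r) beta_S] is [p] times an integer prime to [p]. Modulo [u], [g_S - r]
    is a multiple of [p^2], and [p beta_S] is a multiple of [p], so the correction changes that
    integer only by a multiple of [p]. *)
Lemma p_unit_in_u_span : (S < k)%N -> exists (w : int) (y : algC),
  [/\ ~~ (p%:Z %| w)%Z, inB y & p%:R * w%:~R = u * y].
Proof.
move=> ltSk; have [S0|S_gt0] := posnP S.
  have [Q QE] := poly_mod_u 'X^n.
  have /dvdzP [w wE] := p_dvd_sub_r_pow.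
  exists w, (pZtoC Q).[a]; split; last 2 first.
  - exact: basis_span_poly.
  - have := congr1 (fun z : int => z%:~R : algC) wE.
    rewrite rmorphB rmorphM /= -pmulrn mulrC => <-.
    by move: QE; rewrite map_polyXn !hornerXn anE => ->; rewrite addrC addKr.
  apply: (contra _ (r_exact ltSk k k_gt0)) => pw.
  by rewrite S0 wE expr2 dvdz_mul.
have [L /dvdzP [w wE] [LE mL]] := beta_level S (leqnn S).
have [Q QE] := poly_mod_u 'X^(p ^ (k - S)).
have [c [y [By yE]]] := p_beta_mod_u S (leqnn S).
have /dvdzP [d dE] : (p%:Z ^+ 2 %| r ^+ (p ^ (k - S)) - r)%Z.
  apply: dvdz_trans (dvdz_exp_sub _ _ (k - S) _ r_frob).
  by rewrite dvdz_exp2l.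
exists (w - p%:Z * (d * c)), ((pZtoC Q).[a] * beta S + (p%:Z * d)%:~R * y); split.
- apply: (contra _ (r_exact ltSk S S_gt0)) => pw'.
  have pw : (p%:Z %| w)%Z.
    by rewrite -[w](subrK (p%:Z * (d * c))) rpredD // dvdz_mulr.
  rewrite mL wE exprSr exprSr -mulrA -(natz (p ^ S)) natrX natz.
  by rewrite dvdz_mul // dvdz_mul.
- by apply: inBD; [apply: basis_span_mulpoly; exact: basis_span_beta | exact: inBZ].
have {}dE : g a S - rC = u * (pZtoC Q).[a] + d%:~R * p%:R ^+ 2.
  have := congr1 (fun z : int => z%:~R : algC) dE.
  rewrite rmorphB rmorphM /= !rmorphXn /= -pmulrn => <-.
  by move: QE; rewrite map_polyXn !hornerXn rmorphXn /= -/(g a S) => ->; ring.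
have {}wE : w%:~R * p%:R = L%:~R :> algC by rewrite wE rmorphM.
rewrite rmorphB !rmorphM /= -!pmulrn mulrBr [p%:R * w%:~R]mulrC wE -LE dE.
have -> : (u * (pZtoC Q).[a] + d%:~R * p%:R ^+ 2) * beta S
   = u * (pZtoC Q).[a] * beta S + d%:~R * p%:R * (p%:R * beta S) by ring.
by rewrite yE; ring.
Qed.

Lemma basis_span_socle x :
  x \in Aint -> inB (p%:R * x) -> inB (u * x) -> inB x.
Proof.
move=> xA Bpx Bux; have uA : u \in Aint by rewrite rpredB ?radical_Aint ?Aint_int.
have [e [y [By xE]]] := basis_span_mod_u _ Bux.
have yA := basis_span_Aint _ By.
(* The combination equals [u * (x - y)], nilpotent modulo [p] because [u^n] is in [p Z[a]]. *)
have pe t : (t <= S)%N -> (p%:Z %| e t)%Z.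
  apply: nilp_mod_coefs => //.
  have -> : \sum_(t < S.+1) (e t)%:~R * beta t = u * (x - y).
    by rewrite mulrBr xE addrK.
  have [Q QE] := u_pow; exists n, ((pZtoC Q).[a] * (x - y) ^+ n).
    by apply: rpredM; [apply: basis_span_Aint; exact: basis_span_poly | rewrite rpredX // rpredB].
  by rewrite exprMn QE mulrA.
have [c [z [Bz zE]]] := sum_p_beta_mod_u (fun t => (e t %/ p)%Z).
(* Subtracting [y] and [z], both in the span, turns [u * x] into the integer [p * c]. *)
pose x2 := x - y - z.
have x2A : x2 \in Aint by apply: rpredB; [exact: rpredB | exact: basis_span_Aint].
have ux2 : u * x2 = p%:R * c%:~R.
  rewrite /x2 !mulrBr xE addrK -[RHS](addrK (u * z)) -zE; congr (_ - _).
  apply: eq_bigr => t _; rewrite [RHS]mulrA; congr (_ * _).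
  by rewrite -{1}(divzK (pe t (ltn_ord t))) rmorphM /= -pmulrn.
have Bpx2 : inB (p%:R * x2).
  by rewrite /x2 !mulrBr; apply: inBB; [apply: inBB => //|]; exact: inBnat.
have Bunit (w : int) : ~~ (p%:Z %| w)%Z -> inB (w%:~R * x2) -> inB x.
  move=> pw Bw; have -> : x = x2 + z + y by rewrite /x2; ring.
  apply: inBD => //; apply: inBD => //; apply: (@zspan_bezout _ w p%:Z) => //.
  by rewrite coprimez_sym /coprimez -[gcdz _ _]/((gcdn p `|w|)%:Z) eqz_nat -/(coprime _ _) prime_coprime.
(* For [S < k], comparing [u * x2 = p * c] with [p * w = u * v] and cancelling [u] gives
   [w * x2 = c * v]. *)
have [ltSk|geSk] := ltnP S k.
  have [w [v [pw Bv vE]]] := p_unit_in_u_span ltSk; apply: (Bunit w) => //.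
  have -> : w%:~R * x2 = c%:~R * v.
    by apply: (mulfI u_neq0); rewrite mulrCA ux2 [RHS]mulrCA -vE; ring.
  exact: inBZ.
have Sk : S = k by apply/eqP; rewrite eqn_leq leSk.
have [L _ [LE _]] := beta_level S (leqnn S).
have {}LE : u * beta S = L%:~R by rewrite -LE /g Sk subnn expn0 expr1.
have nilp_beta (f : int) : nilp_mod p (f%:~R * beta S) -> (p%:Z %| f)%Z.
  move=> Nf; have := nilp_mod_last S (fun t => if t == S then f else 0) (leqnn S).
  rewrite eqxx; apply; rewrite big_ord_recr /= eqxx big1 ?add0r // => t _.
  by rewrite ltn_eqF ?mul0r.
(* If [L] were zero, so would be [beta S], and [nilp_beta] with [f = 1] would make [p] divide 1. *)
have L0 : L != 0.
  apply/negP => /eqP L0; have : (p%:Z %| 1)%Z.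
    apply: nilp_beta; have -> : beta S = 0.
      by apply: (mulfI u_neq0); rewrite LE L0 mulr0.
    by rewrite mulr0 -(mulr0 p%:R); apply: nilp_mod_mulp; exact: rpred0.
  by rewrite dvdzE /= dvdn1 => /eqP p1; move: (p_pr); rewrite p1.
(* Dividing [u * beta S = L] and [u * x2 = p * c] by their common gcd gives [A * x2 = B * beta S]
   with [A], [B] coprime. If [p | A], then [B * beta S] is nilpotent modulo [p], so [p | B], a
   contradiction. *)
pose q := gcdz L (p%:Z * c).
have q0 : q != 0 by rewrite /q gcdz_eq0 negb_and L0.
have /dvdzP [A AE] : (q %| L)%Z by exact: dvdz_gcdl.
have /dvdzP [B BE] : (q %| p%:Z * c)%Z by exact: dvdz_gcdr.
have coAB : coprimez A B.
  have q'0 : `|q|%:Z != 0 by rewrite eqz_nat absz_eq0.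
  by apply/eqP/(mulIf q'0); rewrite mulz_gcdl mul1r /= -AE -BE.
have ABE : A%:~R * x2 = B%:~R * beta S.
  have qC0 : q%:~R != 0 :> algC by rewrite intr_eq0.
  apply: (mulfI qC0); apply: (mulfI u_neq0).
  have := congr1 (fun z : int => z%:~R : algC) AE.
  have := congr1 (fun z : int => z%:~R : algC) BE.
  rewrite !rmorphM /= -pmulrn => BE' AE'.
  transitivity (A%:~R * q%:~R * (u * x2)); first by ring.
  rewrite ux2 BE' -AE' -LE; ring.
have [pA|pA] := boolP (p%:Z %| A)%Z; last first.
  by apply: (Bunit A) => //; rewrite ABE; apply: inBZ; exact: basis_span_beta.
have pB : (p%:Z %| B)%Z.
  apply: nilp_beta; rewrite -ABE; have /dvdzP [A' ->] := pA.
  rewrite rmorphM /= -pmulrn mulrAC mulrC; apply: nilp_mod_mulp.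
  by rewrite rpredM ?Aint_int.
have : (p%:Z %| gcdz A B)%Z by rewrite dvdz_gcd pA.
rewrite (eqP coAB) dvdzE /= dvdn1 => /eqP p1.
by move: (p_pr); rewrite p1.
Qed.

(** Two nested descents: factors [p] are removed one at a time, and for each, [u^n * x] lies in [p
    Z[a] * x], hence in the span, so factors [u] are removed one at a time by [basis_span_socle]. *)
Lemma basis_span_div_pow j x : x \in Aint -> inB (p%:R ^+ j * x) -> inB x.
Proof.
move=> xA; elim: j => [|j IH]; first by rewrite mul1r.
rewrite exprS -mulrA => Bpx; apply: IH.
move: (p%:R ^+ j * x) (rpredM (rpredX j (rpred_nat Aint p)) xA) Bpx => {xA}x xA Bpx.
have uA : u \in Aint by rewrite rpredB ?radical_Aint ?Aint_int.
have Bux : inB (u ^+ n * x).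
  by have [Q ->] := u_pow; rewrite mulrAC mulrC; exact: basis_span_mulpoly.
elim: n x xA Bpx Bux => [|i IHi] x xA Bpx; first by rewrite mul1r.
rewrite exprSr -mulrA => Bux; apply: basis_span_socle => //; apply: IHi => //.
  by rewrite rpredM.
by rewrite mulrCA; exact: basis_span_mulu.
Qed.

Lemma basis_span_ring_of_integers x : in_ring_of_integers a x -> inB x.
Proof.
case=> xQ xA; apply: (@basis_span_div_pow k) => //; rewrite -natrX.
have [G szG xE] := @radical_reduced m n a n_gt0 anE x xQ.
rewrite xE (@horner_coef_wide _ n) ?(leq_trans (size_poly _ _)) // mulr_sumr.
apply: zspan_sum => i _; rewrite coef_map /= mulrA.
rewrite xE in xA.
have [c cE] := @radical_coef_int m n a m_sqf m_neq1 m_neqN1 n_gt0 anE G i szG (ltn_ord i) xA.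
have -> : (p ^ k)%:R * ratr G`_i = c%:~R :> algC.
  by rewrite -(rmorph_nat (ratr : {rmorphism rat -> algC})) -rmorphM cE /= ratr_int.
by apply: inBZ; exact: basis_span_pow.
Qed.

End PurePrimePower.

(** * Independence and conclusion *)

Lemma row_poly_horner (n : nat) (a : algC) (v : 'rV[rat]_n) :
  (pQtoC (rVpoly v)).[a] = \sum_(j < n) ratr (v 0 j) * a ^+ j.
Proof.
rewrite (@horner_coef_wide _ n); last exact: leq_trans (size_poly _ _) (size_poly _ _).
by apply: eq_bigr => j _; rewrite coef_map coef_rVpoly_ord.
Qed.

(* With [A] and [P] the change of basis matrices between [b] and the powers of
   [a], freeness of the powers gives [A P = 1], hence [P A = 1]. *)
Lemma spanning_family_free (n : nat) (a : algC) (b : seq algC) :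
  size b = n ->
  (forall G : {poly rat}, (size G <= n)%N -> (pQtoC G).[a] = 0 -> G = 0) ->
  (forall x, x \in b -> exists2 G : {poly rat}, (size G <= n)%N & x = (pQtoC G).[a]) ->
  (forall d, (d < n)%N -> zspan b (a ^+ d)) ->
  forall c : 'I_(size b) -> int,
    \sum_(i < size b) (c i)%:~R * b`_i = 0 -> forall i, c i = 0.
Proof.
move=> szb; case: n / szb => free_pow b_pow span_pow c c0.
have free_row (v : 'rV[rat]_(size b)) : \sum_j ratr (v 0 j) * a ^+ j = 0 -> v = 0.
  move=> v0; rewrite -(rVpolyK v) (free_pow (rVpoly v)) ?raddf0 //.
    exact: size_poly.
  by rewrite row_poly_horner.
have /fin_all_exists [G GP] : forall i : 'I_(size b), exists G : {poly rat},
    (size G <= size b)%N /\ b`_i = (pQtoC G).[a].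
  by move=> i; have [|G szG GE] := b_pow b`_i; [rewrite mem_nth | exists G].
have /fin_all_exists [A AP] : forall d : 'I_(size b), exists A : 'I_(size b) -> int,
    a ^+ d = \sum_(i < size b) (A i)%:~R * b`_i.
  by move=> d; apply: span_pow.
pose P : 'M[rat]_(size b) := \matrix_(i, j) (G i)`_j.
pose M : 'M[rat]_(size b) := \matrix_(d, i) (A d i)%:~R.
have mulP (v : 'I_(size b) -> int) :
    \sum_(j < size b) ratr (((\row_i (v i)%:~R) *m P) 0 j) * a ^+ j
    = \sum_(i < size b) (v i)%:~R * b`_i :> algC.
  under eq_bigr do rewrite mxE rmorph_sum mulr_suml.
  rewrite exchange_big; apply: eq_bigr => i _.
  have [szG ->] := GP i; rewrite (@horner_coef_wide _ (size b)); last first.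
    exact: leq_trans (size_poly _ _) szG.
  rewrite mulr_sumr; apply: eq_bigr => j _.
  by rewrite !mxE rmorphM /= rmorph_int coef_map -[LHS]mulrA.
have MP1 : M *m P = 1%:M.
  apply/row_matrixP => d; rewrite row_mul row1; apply/eqP; rewrite -subr_eq0; apply/eqP.
  apply: free_row; have -> : row d M = \row_i (A d i)%:~R.
    by apply/rowP => i; rewrite !mxE.
  under eq_bigr do rewrite mxE rmorphD mulrDl.
  rewrite big_split /= mulP -AP (bigD1 d) //= big1 ?addr0 => [|j /negPf neq_jd].
    by rewrite !mxE !eqxx rmorphN1 mulN1r subrr.
  by rewrite !mxE neq_jd andbF oppr0 rmorph0 mul0r.
have PM1 := mulmx1C MP1.
have cP0 : \row_i (c i)%:~R *m P = 0 by apply: free_row; rewrite mulP c0.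
move=> i; have := congr1 (fun v : 'rV[rat]_(size b) => (v *m M) 0 i) cP0.
by rewrite -mulmxA PM1 mulmx1 mul0mx !mxE => /eqP; rewrite intr_eq0 => /eqP.
Qed.

Lemma basis_i_integral (p k S : nat) (m r : int) (a : algC) :
  squarefree_int m -> m != 1 -> m != -1 -> prime p -> (0 < k)%N ->
  a ^+ (p ^ k) = m%:~R -> (S <= k)%N -> ~~ (p%:Z %| r)%Z ->
  (p%:Z ^+ S.+1 %| r ^+ p - r)%Z ->
  (forall t, (t <= S)%N -> (p%:Z ^+ t.+1 %| m - r ^+ (p ^ t))%Z) ->
  ((S < k)%N -> forall j, (0 < j)%N -> ~~ (p%:Z ^+ S.+2 %| m - r ^+ (p ^ j))%Z) ->
  integral_basis a (basis_i p k r a S).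
Proof.
move=> m_sqf m1 mN1 p_pr k_gt0 anE leSk r_cop r_frob r_approx r_exact.
have p_gt0 := prime_gt0 p_pr.
have n_gt0 : (0 < p ^ k)%N by rewrite expn_gt0 p_gt0.
have b_int x : x \in basis_i p k r a S -> in_ring_of_integers a x.
  exact: (basis_ring_of_integers p k S m r a).
split.
- by move=> i; apply: b_int; rewrite mem_nth.
- by move=> x; exact: (basis_span_ring_of_integers p k S m r a).
apply: (@spanning_family_free (p ^ k) a); first exact: size_basis_i.
- by move=> G; exact: (radical_coef_eq0 m).
- by move=> x /b_int [xQ _]; exact: (radical_reduced m (p ^ k)).
by move=> d _; exact: (basis_span_pow p k S m r a).
Qed.

(** * Transfer of congruences from [m] to its remainder [r] *)

Lemma r_val_sub (p k : nat) (m : int) :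
  (p%:Z ^+ k.+1 %| m - r_val p k m)%Z.
Proof.
rewrite /r_val -(natz (p ^ k.+1)) natrX natz {1}(divz_eq m (p%:Z ^+ k.+1)) addrK.
exact: dvdz_mull.
Qed.

(** By Fermat the valuation of [m^p - m] is at least 1, so the truncated subtraction in [s_val] is a
    true one. *)
Lemma s_valP (p : nat) (m : int) :
  prime p -> m ^+ p != m ->
  (p%:Z ^+ (s_val p m).+1 %| m ^+ p - m)%Z /\ ~~ (p%:Z ^+ (s_val p m).+2 %| m ^+ p - m)%Z.
Proof.
move=> p_pr mp; have d0 : (0 < absz (m ^+ p - m))%N by rewrite absz_gt0 subr_eq0.
have l0 : (0 < logn p (absz (m ^+ p - m)))%N.
  by rewrite logn_gt0 mem_primes p_pr d0; exact: prime_dvdz_fermat.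
rewrite !dvdzE !abszX !pfactor_dvdn // /s_val subn1 prednK // leqnn.
by rewrite ltnn.
Qed.

Lemma squarefree_not_frob_fixed (p : nat) (m : int) :
  (1 < p)%N -> squarefree_int m -> m != 1 -> m != -1 -> m ^+ p != m.
Proof.
move=> p1 [m0 _] m1 mN1; apply/negP => /eqP mp.
have gt1 : (1 < absz m)%N by lia.
have := congr1 absz mp; rewrite abszX => /eqP.
by rewrite -{2}(expn1 (absz m)) eqn_exp2l // gtn_eqF.
Qed.

Lemma basis_i_r_val (m : int) (k p S : nat) (a : algC) :
  squarefree_int m -> m != 1 -> m != -1 ->
  (0 < k)%N -> prime p -> ~~ (p %| absz m)%N ->
  a ^+ (p ^ k) = m%:~R -> (S <= k)%N -> (S <= s_val p m)%N ->
  ((S < k)%N -> S = s_val p m) ->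
  integral_basis a (basis_i p k (r_val p k m) a S).
Proof.
move=> m_sqf m1 mN1 k_gt0 p_pr p_m anE leSk leSs eqSs.
have [ms ms1] := s_valP p m p_pr (squarefree_not_frob_fixed p m (prime_gt1 p_pr) m_sqf m1 mN1).
have mr := r_val_sub p k m; set r := r_val p k m in mr *.
have dvd_le e f (x : int) : (e <= f)%N -> (p%:Z ^+ f %| x)%Z -> (p%:Z ^+ e %| x)%Z.
  by move=> le_ef; apply: dvdz_trans; rewrite dvdz_exp2l.
have mX : (p%:Z ^+ S.+1 %| m ^+ p - m)%Z by exact: dvd_le ms.
have pow_mr e : (p%:Z ^+ k.+1 %| m ^+ e - r ^+ e)%Z by exact: dvdz_subX.
apply: (@basis_i_integral p k S m) => //.
- apply: contra p_m => pr; suff : (p%:Z %| m)%Z by rewrite dvdzE.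
  rewrite -[m](subrK r) rpredD //; apply: dvdz_trans mr.
  by rewrite exprS dvdz_mulr.
- have -> : r ^+ p - r = (m ^+ p - m) - (m ^+ p - r ^+ p) + (m - r) by ring.
  by apply: rpredD; [apply: rpredB|] => //; apply: (dvd_le _ k.+1).
- move=> t le_tS.
  have -> : m - r ^+ (p ^ t) = (m ^+ (p ^ t) - r ^+ (p ^ t)) - (m ^+ (p ^ t) - m) by ring.
  rewrite rpredB //; first by rewrite (dvd_le _ k.+1) // ltnS (leq_trans le_tS).
  by apply: (dvd_le _ S.+1) => //; exact: dvdz_exp_sub.
(* Lifting [m^(p^j) = m] modulo [p^(s+1)] gives [m^(p^(j+1)) = m^p] modulo [p^(s+2)]. As
   [s + 2 <= k + 1], [r] may replace [m], so divisibility of [m - r^(p^(j+1))] would contradict the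
   definition of [s]. *)
move=> ltSk [//|j] _; apply: contra ms1; rewrite -(eqSs ltSk) => mrj.
have -> : m ^+ p - m = (m ^+ (p ^ j.+1) - r ^+ (p ^ j.+1)) - (m - r ^+ (p ^ j.+1))
    - ((m ^+ (p ^ j)) ^+ p - m ^+ p) by rewrite -exprM -expnSr; ring.
rewrite rpredB //; last by apply: dvdz_lift; exact: dvdz_exp_sub.
by rewrite rpredB // (dvd_le _ k.+1).
Qed.

Theorem theorem3p7 (m : int) (k p : nat) (a : algC) :
  squarefree_int m -> m != 1 -> m != -1 ->
  (0 < k)%N -> prime p -> ~~ (p %| absz m)%N ->
  a ^+ (p ^ k) = m%:~R ->
  ((s_val p m < k)%N -> integral_basis a (basis_i p k (r_val p k m) a (s_val p m))) /\
  ((k <= s_val p m)%N -> integral_basis a (basis_ii p k (r_val p k m) a)).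
Proof.
move=> m_sqf m1 mN1 k_gt0 p_pr p_m anE; split=> [lt_sk|le_ks].
  by apply: (@basis_i_r_val m) => //; exact: ltnW.
(* At [S = k] the last level has [p^0 = 1] element, the one with [j = 0]. *)
have -> : basis_ii p k (r_val p k m) a = basis_i p k (r_val p k m) a k.
  by rewrite /basis_i subnn.
by apply: (@basis_i_r_val m) => //; rewrite ltnn.
Qed.
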